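(* Assume that all coefficients $p_j,\hat a_j,\sigma_j$ ($j\in N$), $b$ and $\Omega$ of (SOCKP) are integer-valued. There is a pseudo-polynomial time algorithm to obtain an exact optimal solution to (SOCKP) when the algorithm uses a pseudo-polynomial time algorithm as a subroutine for the ordinary binary knapsack problem.
   Context: $N=\{1,\dots,n\}$ is a set of items; item $j$ has profit $p_j\ge0$, mean weight $\hat a_j\ge0$ and standard deviation $\sigma_j\ge0$; $b\ge0$ is the capacity and $\Omega>0$ a parameter. (SOCKP): maximize $\sum_{j\in N}p_jx_j$ subject to $\sum_{j\in N}\hat a_jx_j+\Omega\sqrt{\sum_{j\in N}\sigma_j^2x_j^2}\le b$, $x\in\{0,1\}^n$. The ordinary binary knapsack problem is: maximize $\sum_{j\in N}p_jx_j$ subject to $\sum_{j\in N}w_jx_j\le c$, $x\in\{0,1\}^n$; here the profits $p_j$ are nonnegative integers, while the weights $w_j$ and capacity $c$ in the subroutine calls may be non-integer (rational). An algorithm runs in pseudo-polynomial time if its running time is bounded by a polynomial in $n$ and the numerical values (not only the encoding lengths) of the input data. *)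

(* Defs.v *)
From HB Require Import structures.
From mathcomp Require Import all_boot all_order all_algebra.
From mathcomp Require Import reals.

Set Implicit Arguments.
Unset Strict Implicit.
Unset Printing Implicit Defensive.

Import Order.TTheory GRing.Theory Num.Theory.

(** * Machine model

    Structured programs over a random-access memory of natural numbers (of
    unbounded size) under the logarithmic cost criterion: every operation is
    charged according to the bit lengths of the numbers and addresses it
    handles, so running times are polynomially related to Turing machine
    times. *)

Definition mem := nat -> nat.

Inductive binop := Plus | Minus | Times | Quot.

Inductive expr :=
  | Cst of nat
  | Fetch of expr
  | Bin of binop & expr & expr.

(* [Call a l d k] runs the subroutine on the [l] cells starting at address
   [a], and copies the first [k] cells of its final memory to address [d]. *)
Inductive cmd :=
  | Skip
  | Store of expr & expr
  | Seq of cmd & cmd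
  | If of expr & cmd & cmd
  | While of expr & cmd
  | Call of expr & expr & expr & expr.

(* Subtraction is truncated; division by zero returns 0. *)
Definition binop_sem (o : binop) : nat -> nat -> nat :=
  match o with Plus => addn | Minus => subn | Times => muln | Quot => divn end.

Fixpoint eval (m : mem) (e : expr) : nat :=
  match e with
  | Cst k => k
  | Fetch a => m (eval m a)
  | Bin o e1 e2 => binop_sem o (eval m e1) (eval m e2)
  end.

Definition bits (v : nat) : nat := (trunc_log 2 v).+1.

(* The product of the bit lengths is the cost of schoolbook multiplication
   and division; it is charged for all four operations. *)
Fixpoint ecost (m : mem) (e : expr) : nat :=
  match e with
  | Cst k => bits k
  | Fetch a => ecost m a + bits (eval m a) + bits (m (eval m a))
  | Bin o e1 e2 => ecost m e1 + ecost m e2 + bits (eval m e1) * bits (eval m e2)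
  end.

Definition block (m : mem) (a l : nat) : seq nat := mkseq (fun i => m (a + i)) l.

Definition paste (m : mem) (a : nat) (s : seq nat) : mem :=
  fun i => if a <= i < a + size s then nth 0 s (i - a) else m i.

Definition copy_cost (a : nat) (s : seq nat) : nat :=
  \sum_(i < size s) (bits (a + i) + bits (nth 0 s i)).

(* [S s t m]: on input [s] the subroutine halts after time [t] with final
   memory [m]. *)
Definition subroutine := seq nat -> nat -> mem -> Prop.

(* [exec S c m t m']: from memory [m], with [S] as subroutine, [c] halts after
   time [t] with memory [m']. The running time of the subroutine is included
   in [t]. *)
Inductive exec (S : subroutine) : cmd -> mem -> nat -> mem -> Prop :=
  | exec_skip m : exec S Skip m 1 m
  | exec_store a e m :
      exec S (Store a e) m
        (ecost m a + ecost m e + bits (eval m a) + bits (eval m e))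
        [eta m with eval m a |-> eval m e]
  | exec_seq c1 c2 m t1 m1 t2 m2 :
      exec S c1 m t1 m1 -> exec S c2 m1 t2 m2 ->
      exec S (Seq c1 c2) m (t1 + t2) m2
  | exec_if_true e c1 c2 m t m' :
      eval m e <> 0 -> exec S c1 m t m' ->
      exec S (If e c1 c2) m (ecost m e + bits (eval m e) + t) m'
  | exec_if_false e c1 c2 m t m' :
      eval m e = 0 -> exec S c2 m t m' ->
      exec S (If e c1 c2) m (ecost m e + bits (eval m e) + t) m'
  | exec_while_true e c m t1 m1 t2 m2 :
      eval m e <> 0 -> exec S c m t1 m1 -> exec S (While e c) m1 t2 m2 ->
      exec S (While e c) m (ecost m e + bits (eval m e) + t1 + t2) m2
  | exec_while_false e c m :
      eval m e = 0 ->
      exec S (While e c) m (ecost m e + bits (eval m e)) m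
  | exec_call a l d k m t m' :
      let arg := block m (eval m a) (eval m l) in
      let res := block m' 0 (eval m k) in
      S arg t m' ->
      exec S (Call a l d k) m
        (ecost m a + ecost m l + ecost m d + ecost m k
         + copy_cost (eval m a) arg + t + copy_cost (eval m d) res)
        (paste m (eval m d) res).

(* The input is placed at addresses 0, 1, ...; all other cells are 0. *)
Definition run (S : subroutine) (c : cmd) : subroutine :=
  fun s t m => exec S c (nth 0 s) t m.

(* With [no_sub], a program gets stuck at its first [Call]. *)
Definition no_sub : subroutine := fun _ _ _ => False.

Definition halts (S : subroutine) (c : cmd) (s : seq nat) : Prop :=
  exists t m, run S c s t m.

(** * Problems and pseudo-polynomial time *)

(* [sol I m]: the memory [m] holds a correct answer for the instance [I]. *)
Record problem := Problem {
  inst : Type;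
  encode : inst -> seq nat;
  sol : inst -> mem -> Prop }.

(* The encodings below list the number of items and all the numerical data, so
   [sumn (encode I)] is the sum of the number of items and of the numerical
   values of the data; a bound by a polynomial in all these quantities is the
   same as a bound by a polynomial in their sum. *)
Definition pseudo_polynomial_algorithm (S : subroutine) (Pb : problem)
    (c : cmd) : Prop :=
  exists q : {poly nat}, forall I : inst Pb, exists t m,
    [/\ run S c (encode I) t m,
        t <= (q.[sumn (encode I)])%R
      & sol I m].

(* 0-1 vectors of length n are functions ['I_n -> bool]. *)
Definition holds_vector n (m : mem) (x : 'I_n -> bool) : Prop :=
  forall j : 'I_n, m j = x j :> nat.

Local Open Scope ring_scope.

Definition total (F : numDomainType) n (v : 'I_n -> F) (x : 'I_n -> bool) : F :=
  \sum_(j < n) v j * (x j)%:R.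

Definition maximizes (F : numDomainType) n (p : 'I_n -> F)
    (feasible : ('I_n -> bool) -> Prop) (x : 'I_n -> bool) : Prop :=
  feasible x /\ forall y, feasible y -> total p y <= total p x.

(** * The ordinary binary knapsack problem, with rational weights and capacity *)

Record kp_inst := KpInst {
  kp_n : nat;
  kp_profit : 'I_kp_n -> nat;
  kp_weight : 'I_kp_n -> rat;
  kp_capacity : rat;
  kp_weight_ge0 : forall j, 0 <= kp_weight j;
  kp_capacity_ge0 : 0 <= kp_capacity }.

Definition kp_feasible n (w : 'I_n -> rat) (c : rat) (x : 'I_n -> bool) : Prop :=
  total w x <= c.

Definition kp_optimal (I : kp_inst) (x : 'I_(kp_n I) -> bool) : Prop :=
  maximizes (fun j => (kp_profit j)%:R : rat)
    (kp_feasible (@kp_weight I) (kp_capacity I)) x.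

(* A rational is given by its numerator and denominator in lowest terms. *)
Definition kp_encode (I : kp_inst) : seq nat :=
  kp_n I :: [seq kp_profit j | j <- enum 'I_(kp_n I)]
         ++ [seq `|numq (kp_weight j)|%N | j <- enum 'I_(kp_n I)]
         ++ [seq `|denq (kp_weight j)|%N | j <- enum 'I_(kp_n I)]
         ++ [:: `|numq (kp_capacity I)|%N; `|denq (kp_capacity I)|%N].

Definition KP : problem :=
  {| inst := kp_inst;
     encode := kp_encode;
     sol := fun I m => exists x, holds_vector m x /\ @kp_optimal I x |}.

(** * The second-order cone knapsack problem *)

Definition sockp_feasible (R : realType) n (a sigma : 'I_n -> R) (b Omega : R)
    (x : 'I_n -> bool) : Prop :=
  \sum_(j < n) a j * (x j)%:R
  + Omega * Num.sqrt (\sum_(j < n) sigma j ^+ 2 * (x j)%:R ^+ 2) <= b.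

(* Nonnegative integer-valued data. *)
Record sockp_inst := SockpInst {
  sockp_n : nat;
  sockp_profit : 'I_sockp_n -> nat;
  sockp_mean : 'I_sockp_n -> nat;
  sockp_stddev : 'I_sockp_n -> nat;
  sockp_capacity : nat;
  sockp_Omega : nat;
  sockp_Omega_gt0 : (0 < sockp_Omega)%N }.

Definition sockp_optimal (R : realType) (I : sockp_inst)
    (x : 'I_(sockp_n I) -> bool) : Prop :=
  maximizes (fun j => (sockp_profit j)%:R : R)
    (sockp_feasible (fun j => (sockp_mean j)%:R : R)
                    (fun j => (sockp_stddev j)%:R)
                    (sockp_capacity I)%:R (sockp_Omega I)%:R) x.

Definition sockp_encode (I : sockp_inst) : seq nat :=
  sockp_n I :: [seq sockp_profit j | j <- enum 'I_(sockp_n I)]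
            ++ [seq sockp_mean j | j <- enum 'I_(sockp_n I)]
            ++ [seq sockp_stddev j | j <- enum 'I_(sockp_n I)]
            ++ [:: sockp_capacity I; sockp_Omega I].

Definition SOCKP (R : realType) : problem :=
  {| inst := sockp_inst;
     encode := sockp_encode;
     sol := fun I m => exists x, holds_vector m x /\ @sockp_optimal R I x |}.

(* Main.v *)
From mathcomp Require Import all_boot all_order all_algebra.
From mathcomp Require Import reals zify.
Require Import Defs.

Set Implicit Arguments.
Unset Strict Implicit.
Unset Printing Implicit Defensive.

Import Order.TTheory GRing.Theory Num.Theory.

(** Write A = sum a_j x_j and V = sum s_j^2 x_j. The cone constraint says that
    A <= b and Om^2 V <= (b - A)^2. For c > 0 the square dominates its tangent
    at c, (b - A)^2 >= 2 c (b - A) - c^2, with equality at c = b - A, which is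
    an integer. So x is feasible with A < b exactly when, for some integer c
    between 1 and b, it satisfies
      2 c A + Om^2 V <= c (2 b - c),
    which is a knapsack constraint with integer weights and capacity. The case
    A = b is covered by a separate constraint for c = 0, where the tangent
    would lose A, namely A + (Om^2 + b) V <= b: it forces V = 0 because
    Om >= 1 ([linearized_sound], [linearized_complete]). The optimum is
    therefore the best of the optima of b + 1 knapsack problems, and every
    optimum of the best of these problems is an answer
    ([sockp_optimal_linearized]).

    The program solves these b + 1 problems with the subroutine, remembers
    the value of c that gave the largest profit, and solves its problem once
    more, this time copying the reply to the output cells. As its last command
    is a call, it cannot halt without a subroutine.

    Running times follow from the syntax. If every memory cell stays below M,
    no loop makes more than M iterations and every call of the subroutine takes
    time at most Y, then a program c runs within [time_bound M Y c], which is
    polynomially bounded as soon as M and Y are ([pb_time_bound]). The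
    predicate [wp] carries this bound and the bound on the memory along with
    the postcondition, so that the verification of the program
    ([sockp_program_spec]) speaks only of memory contents. Both bounds are
    polynomial in the sum N of the data: the largest number written has order
    N^4, and a knapsack instance has O(n) entries. *)

(** * Time bounds read off the syntax *)

Lemma bits_le v : bits v <= v.+1.
Proof.
rewrite ltnS; case: v => [|v]; first by rewrite trunc_log0.
by apply: leq_trans (ltnW (ltn_expl _ (isT : 1 < 2))) (trunc_logP _ _).
Qed.

Definition bounded (M : nat) (m : mem) : Prop := forall i, m i <= M.

Fixpoint value_bound (M : nat) (e : expr) : nat :=
  match e with
  | Cst k => k
  | Fetch _ => M
  | Bin Plus e1 e2 => value_bound M e1 + value_bound M e2
  | Bin Times e1 e2 => value_bound M e1 * value_bound M e2
  | Bin _ e1 _ => value_bound M e1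
  end.

Fixpoint expr_bound (M : nat) (e : expr) : nat :=
  match e with
  | Cst k => k.+1
  | Fetch a => expr_bound M a + (value_bound M a).+1 + M.+1
  | Bin _ e1 e2 => expr_bound M e1 + expr_bound M e2
                   + (value_bound M e1).+1 * (value_bound M e2).+1
  end.

Lemma eval_le M m e : bounded M m -> eval m e <= value_bound M e.
Proof.
move=> bm; elim: e => [k|a _|o e1 IH1 e2 IH2] //=; case: o => /=.
- exact: leq_add.
- exact: leq_trans (leq_subr _ _) IH1.
- exact: leq_mul.
- exact: leq_trans (leq_div _ _) IH1.
Qed.

Lemma bits_eval_le M m e :
  bounded M m -> bits (eval m e) <= (value_bound M e).+1.
Proof. by move=> bm; apply: leq_trans (bits_le _) _; rewrite ltnS eval_le. Qed.

Lemma ecost_le M m e : bounded M m -> ecost m e <= expr_bound M e.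
Proof.
move=> bm; elim: e => [k|a IH|o e1 IH1 e2 IH2] /=; first exact: bits_le.
- rewrite !leq_add ?bits_eval_le //.
  by apply: leq_trans (bits_le _) _; rewrite ltnS.
- by rewrite !leq_add ?leq_mul ?bits_eval_le.
Qed.

(** The length of a loop is a semantic matter; [M] stands in for the number of
    iterations of every loop, which [wp_while] justifies. Both branches of a
    conditional are counted, a sum being easier to keep polynomial than a
    maximum. *)
Fixpoint time_bound (M Y : nat) (c : cmd) : nat :=
  match c with
  | Skip => 1
  | Store a e => expr_bound M a + expr_bound M e
                 + (value_bound M a).+1 + (value_bound M e).+1
  | Seq c1 c2 => time_bound M Y c1 + time_bound M Y c2
  | If e c1 c2 => expr_bound M e + (value_bound M e).+1
                  + (time_bound M Y c1 + time_bound M Y c2)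
  | While e c => M * (expr_bound M e + (value_bound M e).+1 + time_bound M Y c)
                 + (expr_bound M e + (value_bound M e).+1)
  | Call a l d k =>
      expr_bound M a + expr_bound M l + expr_bound M d + expr_bound M k
      + value_bound M l * (value_bound M a + value_bound M l + 1 + (M + 1))
      + Y
      + value_bound M k * (value_bound M d + value_bound M k + 1 + (M + 1))
  end.

Lemma copy_cost_le M a s :
  (forall i, i < size s -> nth 0 s i <= M) ->
  copy_cost a s <= size s * (a + size s + 1 + (M + 1)).
Proof.
move=> sM; rewrite /copy_cost -[X in X * _]card_ord -sum_nat_const.
apply: leq_sum => i _; have := sM i (ltn_ord i).
have := bits_le (a + i); have := bits_le (nth 0 s i); have := ltn_ord i; lia.
Qed.

(** * Polynomial boundedness *)

Definition polynomially_bounded (f : nat -> nat) : Prop :=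
  exists q : {poly nat}, forall N, f N <= (q.[N])%R.

Lemma pb_cst k : polynomially_bounded (fun=> k).
Proof. by exists (k%:P)%R => N; rewrite hornerC. Qed.

Lemma pb_id : polynomially_bounded id.
Proof. by exists 'X%R => N; rewrite hornerX. Qed.

Lemma pb_add f g : polynomially_bounded f -> polynomially_bounded g ->
  polynomially_bounded (fun N => f N + g N).
Proof.
by move=> [p fp] [q gq]; exists (p + q)%R => N; rewrite hornerD leq_add.
Qed.

Lemma pb_mul f g : polynomially_bounded f -> polynomially_bounded g ->
  polynomially_bounded (fun N => f N * g N).
Proof.
by move=> [p fp] [q gq]; exists (p * q)%R => N; rewrite hornerM leq_mul.
Qed.

Lemma pb_succ f : polynomially_bounded f ->
  polynomially_bounded (fun N => (f N).+1).
Proof.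
move=> pf; case: (pb_add pf (pb_cst 1)) => q fq; exists q => N.
by rewrite -addn1.
Qed.

(** Without negative coefficients, evaluation is monotone; this is what makes
    polynomial bounds compose. *)
Lemma horner_nat_homo (q : {poly nat}) : {homo horner q : x y / x <= y}.
Proof.
move=> x y le_xy; rewrite !horner_coef; apply: leq_sum => i _.
apply: leq_mul => //.
have expE z k : (z ^+ k)%R = z ^ k :> nat.
  by elim: k => // k IH; rewrite exprS IH expnS.
by rewrite !expE; case: (val i) => // k; rewrite leq_exp2r.
Qed.

Lemma pb_comp f (q : {poly nat}) : polynomially_bounded f ->
  polynomially_bounded (fun N => (q.[f N])%R).
Proof.
move=> [p fp]; exists (q \Po p)%R => N; rewrite horner_comp.
exact: horner_nat_homo.
Qed.

Lemma pb_value_bound M e : polynomially_bounded M ->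
  polynomially_bounded (fun N => value_bound (M N) e).
Proof.
move=> pM; elim: e => [k|a _|[] e1 IH1 e2 IH2] //=.
- exact: pb_cst.
- exact: pb_add.
- exact: pb_mul.
Qed.

Lemma pb_expr_bound M e : polynomially_bounded M ->
  polynomially_bounded (fun N => expr_bound (M N) e).
Proof.
move=> pM; elim: e => [k|a IH|o e1 IH1 e2 IH2] /=; first exact: pb_cst.
- by do !(apply: pb_add || apply: pb_succ || apply: pb_value_bound).
- by do !(apply: pb_add || apply: pb_mul || apply: pb_succ ||
          apply: pb_value_bound).
Qed.

Lemma pb_time_bound M Y c : polynomially_bounded M -> polynomially_bounded Y ->
  polynomially_bounded (fun N => time_bound (M N) (Y N) c).
Proof.
move=> pM pY.
have pV e := pb_value_bound e pM; have pE e := pb_expr_bound e pM.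
have p1 := pb_cst 1.
elim: c => [|a e|c1 IH1 c2 IH2|e c1 IH1 c2 IH2|e c IH|a l d k] //=;
  by do ![assumption | apply: pb_add | apply: pb_mul | apply: pb_succ
         | exact: pV].
Qed.

(** * Total correctness with implicit time *)

Section Logic.

Variables (S : subroutine) (M Y : nat).

(** The bound [M] on the memory is a hypothesis of the triple and part of its
    conclusion, so it never has to be mentioned by the invariants: the only
    obligation it leaves is in [wp_store] and [wp_call], for the new values. *)
Definition wp (c : cmd) (m : mem) (Q : mem -> Prop) : Prop :=
  bounded M m ->
  exists t m', [/\ exec S c m t m', t <= time_bound M Y c, bounded M m' & Q m'].

Lemma wp_conseq c m (Q Q' : mem -> Prop) :
  (forall m', Q m' -> Q' m') -> wp c m Q -> wp c m Q'.
Proof.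
move=> QQ' wQ bm; have [t [m' [e le_t bm' Qm']]] := wQ bm.
by exists t, m'; split=> //; apply: QQ'.
Qed.

Lemma wp_skip m (Q : mem -> Prop) : Q m -> wp Skip m Q.
Proof. by move=> Qm bm; exists 1, m; split=> //; constructor. Qed.

Lemma wp_store a e m x v (Q : mem -> Prop) :
  eval m a = x -> eval m e = v -> v <= M ->
  Q [eta m with x |-> v] -> wp (Store a e) m Q.
Proof.
move=> <- <- vM Qm bm; eexists _, _; split; [exact: exec_store| | |exact: Qm].
- by rewrite !leq_add ?ecost_le ?bits_eval_le.
- by move=> i /=; case: ifP.
Qed.

Lemma wp_seq c1 c2 m (Q : mem -> Prop) :
  wp c1 m (fun m1 => wp c2 m1 Q) -> wp (Seq c1 c2) m Q.
Proof.
move=> w1 bm; have [t1 [m1 [e1 le1 bm1 w2]]] := w1 bm.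
have [t2 [m2 [e2 le2 bm2 Qm2]]] := w2 bm1.
exists (t1 + t2), m2; split=> //; first exact: exec_seq e1 e2.
by rewrite leq_add.
Qed.

Lemma wp_if e c1 c2 m (Q : mem -> Prop) :
  (eval m e <> 0 -> wp c1 m Q) -> (eval m e = 0 -> wp c2 m Q) ->
  wp (If e c1 c2) m Q.
Proof.
move=> w1 w2 bm; have [e0|/eqP ne0] := eqVneq (eval m e) 0.
- have [t [m' [ex le_t bm' Qm']]] := w2 e0 bm.
  eexists _, m'; split; [exact: exec_if_false ex| |exact: bm'|exact: Qm'].
  have := ecost_le e bm; have := bits_eval_le e bm; move: le_t => /=; lia.
- have [t [m' [ex le_t bm' Qm']]] := w1 ne0 bm.
  eexists _, m'; split; [exact: exec_if_true ex| |exact: bm'|exact: Qm'].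
  have := ecost_le e bm; have := bits_eval_le e bm; move: le_t => /=; lia.
Qed.

(** The value of the loop condition is required to decrease by exactly one at
    each iteration. It is then the number of remaining iterations, and it is
    at most [M]. *)
Lemma wp_while e c (Inv : nat -> mem -> Prop) k m :
  (forall i m, Inv i m -> eval m e = i) ->
  (forall i m, Inv i.+1 m -> wp c m (Inv i)) ->
  k <= M -> Inv k m -> wp (While e c) m (Inv 0).
Proof.
move=> Inv_eval body kM Invk bm.
set D := expr_bound M e + (value_bound M e).+1.
have condD m1 : bounded M m1 -> ecost m1 e + bits (eval m1 e) <= D.
  by move=> bm1; rewrite leq_add ?ecost_le ?bits_eval_le.
suff [t [m' [ex le_t bm' Im']]] : exists t m', [/\ exec S (While e c) m t m',
    t <= k * (D + time_bound M Y c) + D, bounded M m' & Inv 0 m'].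
  exists t, m'; split=> //; apply: leq_trans le_t _.
  by rewrite leq_add2r leq_mul2r kM orbT.
elim: k m Invk bm {kM} => [|k IH] m Invk bm.
  have e0 := Inv_eval _ _ Invk.
  eexists _, m; split; [exact: exec_while_false| |exact: bm|exact: Invk].
  by rewrite mul0n add0n condD.
have [t1 [m1 [ex1 le1 bm1 Inv1]]] := body _ _ Invk bm.
have [t2 [m2 [ex2 le2 bm2 Inv2]]] := IH _ Inv1 bm1.
eexists _, m2; split; [|  |exact: bm2|exact: Inv2].
  by apply: exec_while_true ex1 ex2; rewrite (Inv_eval _ _ Invk).
have := condD _ bm; rewrite mulSn; lia.
Qed.

Lemma wp_call a l d k m x y z w (Q : mem -> Prop) :
  eval m a = x -> eval m l = y -> eval m d = z -> eval m k = w ->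
  (bounded M m -> exists t m', [/\ S (block m x y) t m', t <= Y,
     forall i, i < w -> m' i <= M & Q (paste m z (block m' 0 w))]) ->
  wp (Call a l d k) m Q.
Proof.
move=> <- <- <- <- call bm; have [t [m' [St le_t bm' Qm']]] := call bm.
eexists _, _; split; [exact: exec_call St| | |exact: Qm'].
- have := @copy_cost_le M (eval m a) (block m (eval m a) (eval m l)).
  have := @copy_cost_le M (eval m d) (block m' 0 (eval m k)).
  rewrite !size_mkseq => c1 c2 /=.
  have {}c1 : copy_cost (eval m d) (block m' 0 (eval m k)) <=
      value_bound M k * (value_bound M d + value_bound M k + 1 + (M + 1)).
    apply: leq_trans (c1 _) _ => [i ik|]; first by rewrite nth_mkseq ?bm'.
    by rewrite leq_mul ?eval_le // !leq_add ?eval_le.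
  have {}c2 : copy_cost (eval m a) (block m (eval m a) (eval m l)) <=
      value_bound M l * (value_bound M a + value_bound M l + 1 + (M + 1)).
    apply: leq_trans (c2 _) _ => [i ik|]; first by rewrite nth_mkseq ?bm.
    by rewrite leq_mul ?eval_le // !leq_add ?eval_le.
  by rewrite !leq_add ?ecost_le.
- move=> i; rewrite /paste; case: ifP => // /andP[ge lt].
  by move: lt; rewrite size_mkseq -ltn_subLR // => lt; rewrite nth_mkseq ?bm'.
Qed.

Definition For (v e : expr) (c : cmd) : cmd :=
  Seq (Store v (Cst 0))
    (While (Bin Minus e (Fetch v))
       (Seq c (Store v (Bin Plus (Fetch v) (Cst 1))))).

(** The address [v] of the counter is an expression, because it depends on the
    number of items; the invariant [P] fixes its value [x]. Since [P] does not
    depend on the contents of that cell, it survives the updates of the counter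
    made by the loop itself. *)
Lemma wp_for v e c x B (P : nat -> mem -> Prop) m :
  B <= M ->
  (forall i m, P i m -> eval m v = x /\ eval m e = B) ->
  (forall i k m, P i m -> P i [eta m with x |-> k]) ->
  (forall i m, i < B -> P i m -> m x = i ->
     wp c m (fun m' => P i.+1 m' /\ m' x = i)) ->
  P 0 m -> wp (For v e c) m (P B).
Proof.
move=> BM Pev Pupd body P0; apply: wp_seq.
have [vx _] := Pev _ _ P0.
apply: (wp_store vx) => //.
pose Inv k m := [/\ k <= B, P (B - k) m & m x = B - k].
apply: (@wp_conseq _ _ (Inv 0)) => [m' [_ + _]|]; first by rewrite subn0.
apply: (wp_while (k := B)) => // [k m1 [kB Pk mx]|k m1 [kB Pk mx]|].
- by have [vx' eB] := Pev _ _ Pk; rewrite /= vx' eB mx subKn.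
- have e1 : (B - k.+1).+1 = B - k by lia.
  apply: wp_seq; apply: wp_conseq (body _ _ _ Pk mx); last by lia.
  rewrite e1 => m2 [Pk2 mx2]; have [vx2 _] := Pev _ _ Pk2.
  apply: (wp_store vx2 (v := B - k)) => //=; first by rewrite vx2 mx2; lia.
    by lia.
  by split; [lia|exact: Pupd|rewrite /= eqxx].
- by split=> //; rewrite subnn ?eqxx //=; [apply: Pupd|rewrite eqxx].
Qed.

End Logic.

Arguments wp_skip {S M Y m Q}.
Arguments wp_store {S M Y a e m x v Q}.

(** * Linearization of the cone constraint *)

Definition weigh n (v : 'I_n -> nat) (x : 'I_n -> bool) : nat :=
  \sum_(j < n) v j * x j.

Lemma total_natr (F : numDomainType) n (v : 'I_n -> nat) (x : 'I_n -> bool) :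
  total (fun j => (v j)%:R : F)%R x = ((weigh v x)%:R)%R.
Proof. by rewrite /weigh natr_sum; apply: eq_bigr => j _; rewrite natrM. Qed.

Lemma maximizes_natr (F : numDomainType) n (p : 'I_n -> nat) feasible
    (x : 'I_n -> bool) :
  maximizes (fun j => (p j)%:R : F)%R feasible x <->
  feasible x /\ forall y, feasible y -> weigh p y <= weigh p x.
Proof.
by split=> -[fx max]; split=> // y /max; rewrite !total_natr ler_nat.
Qed.

Lemma natr_ge0 (k : nat) : (0 <= k%:R :> rat)%R.
Proof. exact: ler0n. Qed.

Definition knapsack n (p w : 'I_n -> nat) (g : nat) : kp_inst :=
  KpInst p (fun j => natr_ge0 (w j)) (natr_ge0 g).

Lemma kp_feasible_nat n (w : 'I_n -> nat) g x :
  kp_feasible (fun j => (w j)%:R)%R (g%:R)%R x <-> weigh w x <= g.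
Proof. by rewrite /kp_feasible total_natr ler_nat. Qed.

Lemma kp_optimalP n (p w : 'I_n -> nat) g (x : 'I_n -> bool) :
  @kp_optimal (knapsack p w g) x <->
  weigh w x <= g /\ forall y, weigh w y <= g -> weigh p y <= weigh p x.
Proof.
rewrite /kp_optimal maximizes_natr kp_feasible_nat.
by split=> -[wx max]; split=> // y /kp_feasible_nat /max.
Qed.

Lemma sockp_feasible_nat (R : realType) n (a s : 'I_n -> nat) b Om x :
  sockp_feasible (fun j => (a j)%:R : R)%R (fun j => (s j)%:R)%R
    (b%:R)%R (Om%:R)%R x <->
  weigh a x <= b /\
  Om ^ 2 * weigh (fun j => s j ^ 2) x <= (b - weigh a x) ^ 2.
Proof.
set A := weigh a x; set V := weigh _ x.
have sumE :
    (\sum_(j < n) ((s j)%:R : R) ^+ 2 * (x j)%:R ^+ 2 = V%:R)%R.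
  rewrite natr_sum; apply: eq_bigr => j _.
  by rewrite natrM natrX; case: (x j); rewrite ?expr1n ?expr0n.
rewrite /sockp_feasible sumE -[X in (X + _)%R]/(total _ x) total_natr -/A.
have sq0 : (0 <= Om%:R * Num.sqrt (V%:R : R))%R.
  by rewrite mulr_ge0 ?ler0n ?sqrtr_ge0.
have sqE : ((Om%:R * Num.sqrt (V%:R : R)) ^+ 2 = (Om ^ 2 * V)%:R)%R.
  by rewrite exprMn sqr_sqrtr ?ler0n // natrM natrX.
split=> [le_b|[leA le_sq]].
  have leA : A <= b.
    by rewrite -(ler_nat R); apply: le_trans le_b; rewrite lerDl.
  split=> //; rewrite -(ler_nat R) -sqE natrX natrB //.
  by rewrite lerXn2r ?nnegrE ?subr_ge0 ?ler_nat // lerBrDl.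
rewrite -lerBrDl -natrB // -(@ler_pXn2r _ 2) ?nnegrE ?ler0n //.
by rewrite sqE -natrX ler_nat.
Qed.

(* In these three definitions the truncated difference 1 - c is the indicator
   of c = 0. *)
Definition mean_coef c := 2 * c + (1 - c).
Definition var_coef b Om c := Om ^ 2 + (1 - c) * b.
Definition linear_capacity b c := c * (2 * b - c) + (1 - c) * b.

(** For c > 0 this is 2 c (b - A) <= c^2 + (b - A)^2. For c = 0 the weight of a
    positive V would exceed b. *)
Lemma linearized_sound A V b Om c : 0 < Om -> c <= b ->
  mean_coef c * A + var_coef b Om c * V <= linear_capacity b c ->
  A <= b /\ Om ^ 2 * V <= (b - A) ^ 2.
Proof.
rewrite /mean_coef /var_coef /linear_capacity => Om0.
case: c => [|c] cb.
  rewrite !(muln0, mul0n, subn0, add0n, mul1n) => le_b.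
  have V0 : V = 0 by apply/eqP; rewrite -leqn0 leqNgt; apply/negP => V0; nia.
  by move: le_b; rewrite V0 !muln0 addn0; lia.
rewrite (_ : 1 - c.+1 = 0) // !mul0n !addn0 => le_b.
have leA : A <= b by nia.
split=> //; have [d eb] : exists d, b = A + d by exists (b - A); lia.
move: le_b; rewrite eb addKn; have := (nat_Cauchy c.+1 d).1.
move: (Om ^ 2 * V) (c.+1) => W C; rewrite -!mulnn !mulnBr !mulnDr; lia.
Qed.

(** At c = b - A the two sides of the tangent inequality coincide. *)
Lemma linearized_complete A V b Om :
  A <= b -> Om ^ 2 * V <= (b - A) ^ 2 -> 0 < Om ->
  mean_coef (b - A) * A + var_coef b Om (b - A) * V
    <= linear_capacity b (b - A).
Proof.
rewrite /mean_coef /var_coef /linear_capacity => leA.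
have [d eb] : exists d, b = A + d by exists (b - A); lia.
rewrite eb addKn; case: d {eb} => [|d] le_sq Om0.
  have -> : V = 0 by nia.
  by lia.
rewrite (_ : 1 - d.+1 = 0) // !mul0n !addn0; nia.
Qed.

Lemma weigh_comb n (a s : 'I_n -> nat) k l x :
  weigh (fun j => k * a j + l * s j) x = k * weigh a x + l * weigh s x.
Proof.
by rewrite /weigh !big_distrr -big_split; apply: eq_bigr => j _ /=; lia.
Qed.

(** * Instances in memory *)

(** The encodings of both problems have this shape: a size, three arrays of
    that size, and two numbers. *)
Definition layout n (f g h : 'I_n -> nat) (x y : nat) : seq nat :=
  n :: [seq f j | j <- enum 'I_n] ++ [seq g j | j <- enum 'I_n]
    ++ [seq h j | j <- enum 'I_n] ++ [:: x; y].

(** The instances passed to the subroutine are integral, so every denominator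
    is 1. *)
Lemma kp_encode_knapsack n (p w : 'I_n -> nat) g :
  kp_encode (knapsack p w g) = layout p w (fun=> 1) g 1.
Proof.
have nq k : `|numq (k%:R : rat)|%N = k by rewrite pmulrn numq_int.
have dq k : `|denq (k%:R : rat)|%N = 1 by rewrite pmulrn denq_int.
rewrite /kp_encode /layout /= nq dq.
by congr (_ :: _ ++ _ ++ _ ++ _); apply: eq_map.
Qed.

(** The addresses are associated in the way in which the program computes
    them, so that evaluating an address expression yields them literally. *)
Definition stores n (f g h : 'I_n -> nat) (x y base : nat) (m : mem) : Prop :=
  [/\ m base = n,
      forall j : 'I_n, [/\ m (base + 1 + j) = f j, m (base + 1 + n + j) = g j
                         & m (base + 1 + 2 * n + j) = h j],
      m (base + 1 + 3 * n) = x
    & m (base + 2 + 3 * n) = y].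

Lemma size_layout n (f g h : 'I_n -> nat) x y :
  size (layout f g h x y) = 3 * n + 3.
Proof. rewrite /= !size_cat !size_map -enumT size_enum_ord /=; lia. Qed.

Lemma block_layout n (f g h : 'I_n -> nat) x y base m :
  block m base (3 * n + 3) = layout f g h x y <-> stores f g h x y base m.
Proof.
have blockE : block m base (3 * n + 3) = m base ::
    [seq m (base + 1 + j) | j : 'I_n <- enum 'I_n] ++
    [seq m (base + 1 + n + j) | j : 'I_n <- enum 'I_n] ++
    [seq m (base + 1 + 2 * n + j) | j : 'I_n <- enum 'I_n] ++
    [:: m (base + 1 + 3 * n); m (base + 2 + 3 * n)].
  have mapE k : [seq m (base + 1 + k + j) | j : 'I_n <- enum 'I_n] =
      [seq m (base + i) | i <- iota (1 + k) n].
    rewrite -[1 + k]addn0 iotaDl -val_enum_ord -!map_comp.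
    by apply: eq_map => j /=; rewrite !addnA.
  have := mapE 0; under eq_map do rewrite addn0; move=> ->.
  rewrite !mapE /block /mkseq.
  have -> : 3 * n + 3 = 1 + (n + (n + (n + 2))) by lia.
  rewrite !iotaD !map_cat /= addn0; congr (_ :: _ ++ _ ++ _ ++ _).
  - by rewrite (_ : 0 + 1 + n + n = 1 + 2 * n) //; lia.
  - by congr [:: m _; m _]; lia.
rewrite blockE /layout /stores; split=> [[-> /eqP]|[-> E -> ->]].
  do 3!rewrite eqseq_cat ?size_map //.
  case/and4P => /eqP/eq_in_map E1 /eqP/eq_in_map E2 /eqP/eq_in_map E3.
  move=> /eqP[-> ->].
  by split=> // j; split; [apply: E1|apply: E2|apply: E3]; rewrite mem_enum.
by congr (_ :: _ ++ _ ++ _ ++ _); apply: eq_map => j; case: (E j).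
Qed.

Lemma stores_layout n (f g h : 'I_n -> nat) x y :
  stores f g h x y 0 (nth 0 (layout f g h x y)).
Proof.
by apply/block_layout; rewrite -(size_layout f g h x y); apply: mkseq_nth.
Qed.

(** * The program and its verification *)

Local Notation "x +' y" := (Bin Plus x y) (at level 50, left associativity).
Local Notation "x -' y" := (Bin Minus x y) (at level 50, left associativity).
Local Notation "x *' y" := (Bin Times x y) (at level 40, left associativity).
Local Notation "c1 ;; c2" := (Seq c1 c2) (at level 90, right associativity).

(* Memory map. The input occupies the addresses below 3n+3, the knapsack
   instance passed to the subroutine those from 3n+3 to 6n+5, its reply those
   from 6n+6 to 7n+5, and the variables start at 9n+9. The number n of items is
   read again from address 0 in each address computation, since no fixed
   address is certain to lie outside the input. *)
Definition nitems : expr := Fetch (Cst 0).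
Definition profit_at (j : expr) : expr := Fetch (Cst 1 +' j).
Definition mean_at (j : expr) : expr := Fetch (Cst 1 +' nitems +' j).
Definition stddev_at (j : expr) : expr :=
  Fetch (Cst 1 +' Cst 2 *' nitems +' j).
Definition capacity : expr := Fetch (Cst 1 +' Cst 3 *' nitems).
Definition omega : expr := Fetch (Cst 2 +' Cst 3 *' nitems).

Definition buffer : expr := Cst 3 *' nitems +' Cst 3.
Definition result : expr := Cst 6 *' nitems +' Cst 6.
Definition var (k : nat) : expr := Cst 9 *' nitems +' Cst (9 + k).

Definition guess := var 0.
Definition item := var 1.
Definition value := var 2.
Definition best := var 3.
Definition best_guess := var 4.

Definition mean_coef_expr : expr :=
  Cst 2 *' Fetch guess +' (Cst 1 -' Fetch guess).
Definition var_coef_expr : expr :=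
  omega *' omega +' (Cst 1 -' Fetch guess) *' capacity.
Definition linear_capacity_expr : expr :=
  Fetch guess *' (Cst 2 *' capacity -' Fetch guess)
  +' (Cst 1 -' Fetch guess) *' capacity.

Definition write_knapsack : cmd :=
  Store buffer nitems ;;
  For item nitems
    (Store (buffer +' Cst 1 +' Fetch item) (profit_at (Fetch item)) ;;
     Store (buffer +' Cst 1 +' nitems +' Fetch item)
       (mean_coef_expr *' mean_at (Fetch item) +'
        var_coef_expr *'
          (stddev_at (Fetch item) *' stddev_at (Fetch item))) ;;
     Store (buffer +' Cst 1 +' Cst 2 *' nitems +' Fetch item) (Cst 1)) ;;
  Store (buffer +' Cst 1 +' Cst 3 *' nitems) linear_capacity_expr ;;
  Store (buffer +' Cst 2 +' Cst 3 *' nitems) (Cst 1).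

Definition evaluate : cmd :=
  Store value (Cst 0) ;;
  For item nitems
    (Store value (Fetch value +'
                  profit_at (Fetch item) *' Fetch (result +' Fetch item))).

(** The address 3n+3 of the instance is also its length, hence the repeated
    argument. *)
Definition solve_knapsack (d : expr) : cmd := Call buffer buffer d nitems.

Definition try_guess : cmd :=
  write_knapsack ;; solve_knapsack result ;; evaluate ;;
  If (Fetch value -' Fetch best)
    (Store best (Fetch value) ;; Store best_guess (Fetch guess)) Skip.

(** Only the profit and the guess of the best reply are kept in the search; the
    last call recomputes a vector and puts it at address 0. It overwrites the
    input, and so has to come last. *)
Definition sockp_program : cmd :=
  (For guess (capacity +' Cst 1) try_guess ;;
   Store guess (Fetch best_guess) ;;
   write_knapsack) ;;
  solve_knapsack (Cst 0).

Section Correctness.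

Variables (n : nat) (p a s : 'I_n -> nat) (b Om : nat).

Definition linearized_weight c (j : 'I_n) : nat :=
  mean_coef c * a j + var_coef b Om c * s j ^ 2.

Local Notation w := linearized_weight.
Local Notation g := (linear_capacity b).

Definition holds_input (m : mem) : Prop := stores p a s b Om 0 m.

(** [slot 0] to [slot 4] are the addresses of the guess, the item counter, the
    profit of the current reply, the best profit and the best guess. *)
Definition slot (k : nat) : nat := 9 * n + (9 + k).

Lemma stores_eq f h1 h2 x y base m m' :
  (forall i, base <= i < base + (3 * n + 3) -> m' i = m i) ->
  @stores n f h1 h2 x y base m -> stores f h1 h2 x y base m'.
Proof.
move=> eqm [E1 E2 E3 E4].
have E j : base <= j < base + (3 * n + 3) -> m j = m' j by move=> /eqm.
split=> [|j||]; first by rewrite -E //; lia.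
- by have := ltn_ord j; case: (E2 j) => <- <- <- ltj; rewrite -!E //; lia.
- by rewrite -E //; lia.
- by rewrite -E //; lia.
Qed.

Lemma input_nitems m : holds_input m -> m 0 = n.
Proof. by case. Qed.

Section Expressions.

Variable m : mem.
Hypothesis inp : holds_input m.

Let m0 : m 0 = n := input_nitems inp.

Lemma eval_capacity : eval m capacity = b.
Proof. by rewrite /= m0; case: inp. Qed.

Lemma eval_omega : eval m omega = Om.
Proof. by rewrite /= m0; case: inp. Qed.

Lemma eval_buffer : eval m buffer = 3 * n + 3.
Proof. by rewrite /= m0. Qed.

Lemma eval_result : eval m result = 6 * n + 6.
Proof. by rewrite /= m0. Qed.

Lemma eval_var k : eval m (var k) = slot k.
Proof. by rewrite /= m0. Qed.

Lemma eval_fetch_var k : eval m (Fetch (var k)) = m (slot k).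
Proof. by rewrite -eval_var. Qed.

Lemma eval_items e (j : 'I_n) : eval m e = j ->
  [/\ eval m (profit_at e) = p j, eval m (mean_at e) = a j
    & eval m (stddev_at e) = s j].
Proof. by rewrite /= m0 => ->; case: inp => _ /(_ j) [E1 E2 E3] _ _. Qed.

Lemma eval_coefs :
  [/\ eval m mean_coef_expr = mean_coef (m (slot 0)),
      eval m var_coef_expr = var_coef b Om (m (slot 0))
    & eval m linear_capacity_expr = g (m (slot 0))].
Proof.
have := eval_fetch_var 0; have := eval_capacity; have := eval_omega.
rewrite /mean_coef /var_coef /linear_capacity /= => -> -> ->.
by rewrite mulnn.
Qed.

End Expressions.

Variables (S : subroutine) (M Y : nat).
Hypothesis n_le : n <= M.
Hypothesis b_lt : b < M.
Hypothesis weight_le : forall c j, c <= b -> w c j <= M.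
Hypothesis g_le : forall c, c <= b -> g c <= M.
Hypothesis p_le : \sum_(j < n) p j <= M.

Definition knapsack_optimal c (x : 'I_n -> bool) : Prop :=
  weigh (w c) x <= g c /\
  forall y, weigh (w c) y <= g c -> weigh p y <= weigh p x.

(* The bound on the entries of the instance comes for free from the bound [M]
   on the memory in which it has been written. *)
Hypothesis solver : forall c,
  sumn (layout p (w c) (fun=> 1) (g c) 1) <= (3 * n + 3) * M ->
  exists t m, [/\ S (layout p (w c) (fun=> 1) (g c) 1) t m, t <= Y
    & exists x, holds_vector m x /\ knapsack_optimal c x].

Lemma weigh_le x : weigh p x <= M.
Proof.
apply: leq_trans p_le; apply: leq_sum => j _.
by case: (x j); rewrite ?muln1 // muln0.
Qed.

Lemma p_le1 j : p j <= M.
Proof. by apply: leq_trans p_le; rewrite (bigD1 j) //= leq_addr. Qed.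

Lemma write_knapsack_spec c m0 : c <= b -> holds_input m0 -> m0 (slot 0) = c ->
  wp S M Y write_knapsack m0 (fun m =>
    stores p (w c) (fun=> 1) (g c) 1 (3 * n + 3) m /\
    forall i, ~~ (3 * n + 3 <= i < 6 * n + 6) -> i != slot 1 -> m i = m0 i).
Proof.
move=> cb inp0 gc.
pose frame (m : mem) :=
  forall i, ~~ (3 * n + 3 <= i < 6 * n + 6) -> i != slot 1 -> m i = m0 i.
have frame_input m : frame m -> holds_input m.
  by move=> fr; apply: stores_eq inp0 => i ?; apply: fr; rewrite /slot; lia.
have frame_c m : frame m -> m (slot 0) = c.
  by move=> fr; rewrite fr //; rewrite /slot; lia.
have frame_upd m i v : frame m -> 3 * n + 3 <= i < 6 * n + 6 ->
    frame [eta m with i |-> v].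
  by move=> fr ii k k1 k2; rewrite /= ifN ?fr //; apply/eqP => ki; lia.
rewrite /write_knapsack; apply: wp_seq.
apply: (wp_store (x := 3 * n + 3) (v := n)) => //; first exact: eval_buffer.
  exact: input_nitems.
set m1 := [eta m0 with _ |-> _].
have fr1 : frame m1 by apply: frame_upd => //; lia.
pose written k (m : mem) := [/\ frame m, m (3 * n + 3) = n &
  forall j : 'I_n, j < k ->
   [/\ m (3 * n + 3 + 1 + j) = p j, m (3 * n + 3 + 1 + n + j) = w c j
     & m (3 * n + 3 + 1 + 2 * n + j) = 1]].
apply: wp_seq; apply: (@wp_conseq _ _ _ _ _ (written n)); last first.
  apply: (wp_for (x := slot 1) (B := n)) => //.
  - move=> k m [fr _ _]; have inp := frame_input _ fr.
    by rewrite eval_var //; split=> //; apply: input_nitems.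
  - move=> k v m [fr Hn H]; split.
    + by move=> i i1 i2; rewrite /= ifN ?fr.
    + by rewrite /= ifN //; rewrite /slot; lia.
    + move=> j /H [E1 E2 E3]; have jn := ltn_ord j.
      by split; rewrite /= ifN ?E1 ?E2 ?E3 //; rewrite /slot; lia.
  - move=> k m kn [fr Hn H] mk.
    have inp := frame_input _ fr.
    pose j := Ordinal kn.
    have ev m' (inp' : holds_input m') : m' (slot 1) = k ->
      eval m' (Fetch item) = j by rewrite eval_fetch_var.
    apply: wp_seq; apply: (wp_store (x := 3 * n + 3 + 1 + k) (v := p j)).
    + by rewrite /= (input_nitems inp) mk.
    + by case: (eval_items inp (ev _ inp mk)).
    + exact: p_le1.
    set m2 := [eta m with _ |-> _].
    have fr2 : frame m2 by apply: frame_upd => //; lia.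
    have m2E i : m2 i = if i == 3 * n + 3 + 1 + k then p j else m i by [].
    (* Simplification of a lookup would otherwise expose the whole update. *)
    clearbody m2.
    have inp2 := frame_input _ fr2.
    have mk2 : m2 (slot 1) = k by rewrite m2E ifN //; rewrite /slot; lia.
    apply: wp_seq; apply: (wp_store (x := 3 * n + 3 + 1 + n + k) (v := w c j)).
    + by rewrite /= (input_nitems inp2) mk2.
    + have [_ Ea Es] := eval_items inp2 (ev _ inp2 mk2).
      have [Em Ev _] := eval_coefs inp2.
      rewrite -[LHS]/(eval m2 mean_coef_expr * eval m2 (mean_at (Fetch item)) +
        eval m2 var_coef_expr * (eval m2 (stddev_at (Fetch item)) *
          eval m2 (stddev_at (Fetch item)))).
      by rewrite Em Ev Ea Es frame_c // mulnn.
    + exact: weight_le.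
    set m3 := [eta m2 with _ |-> _].
    have fr3 : frame m3 by apply: frame_upd => //; lia.
    have m3E i :
      m3 i = if i == 3 * n + 3 + 1 + n + k then w c j else m2 i by [].
    clearbody m3.
    have inp3 := frame_input _ fr3.
    have mk3 : m3 (slot 1) = k by rewrite m3E ifN //; rewrite /slot; lia.
    apply: (wp_store (x := 3 * n + 3 + 1 + 2 * n + k) (v := 1)) => //.
    + by rewrite /= (input_nitems inp3) mk3.
    + by apply: leq_trans b_lt.
    set m4 := [eta m3 with _ |-> _].
    have fr4 : frame m4 by apply: frame_upd => //; lia.
    have m4E i :
      m4 i = if i == 3 * n + 3 + 1 + 2 * n + k then 1 else m3 i by [].
    clearbody m4.
    split; last by rewrite m4E ifN //; rewrite /slot; lia.
    split=> //.
      by rewrite m4E m3E m2E !ifN //; lia.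
    move=> i ik; have in_ := ltn_ord i.
    have [ei|ne] := eqVneq (i : nat) k.
      have -> : i = j by apply: val_inj.
      split; rewrite (erefl : j = k :> nat) m4E m3E m2E ?eqxx //;
        by rewrite !ifN ?eqxx //; lia.
    have /H [E1 E2 E3] : i < k by lia.
    by split; rewrite m4E m3E m2E !ifN //; lia.
  - by split=> //; rewrite /m1 /= eqxx.
move=> m [fr Hn H]; have inp := frame_input _ fr.
apply: wp_seq.
apply: (wp_store (x := 3 * n + 3 + 1 + 3 * n) (v := g c)).
- by rewrite /= (input_nitems inp).
- by case: (eval_coefs inp) => _ _ ->; rewrite frame_c.
- exact: g_le.
set m2 := [eta m with _ |-> _].
have fr2 : frame m2 by apply: frame_upd => //; lia.
have m2E i : m2 i = if i == 3 * n + 3 + 1 + 3 * n then g c else m i by [].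
clearbody m2.
have inp2 := frame_input _ fr2.
apply: (wp_store (x := 3 * n + 3 + 2 + 3 * n) (v := 1)) => //.
- by rewrite /= (input_nitems inp2).
- by apply: leq_trans b_lt.
split; last by apply: frame_upd => //; lia.
split=> [|j||] /=; rewrite ?eqxx //.
- by rewrite m2E !ifN //; lia.
- have jn := ltn_ord j; have [E1 E2 E3] := H j jn.
  by split; rewrite m2E !ifN ?E1 ?E2 ?E3 //; lia.
- by rewrite m2E ifN ?eqxx //; lia.
Qed.

Lemma sumn_block_le m x l : bounded M m -> sumn (block m x l) <= l * M.
Proof.
move=> bm; rewrite /block /mkseq -[X in X * M](size_iota 0).
by elim: (iota 0 l) => //= i r IH; rewrite mulSn leq_add.
Qed.

(** The destination [D] is the reply area during the search, and the output
    area in the final call. *)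
Lemma solve_knapsack_spec c d D m0 : c <= b -> holds_input m0 ->
  stores p (w c) (fun=> 1) (g c) 1 (3 * n + 3) m0 -> eval m0 d = D ->
  wp S M Y (solve_knapsack d) m0 (fun m => exists x, [/\ knapsack_optimal c x,
    forall j : 'I_n, m (D + j) = x j
    & forall i, ~~ (D <= i < D + n) -> m i = m0 i]).
Proof.
move=> cb inp /block_layout blk dD; have L := eval_buffer inp.
apply: (wp_call L L dD (w := n)); first exact: input_nitems.
move=> bm; rewrite blk.
have /solver [t [m [St tY [x [mx optx]]]]] :
    sumn (layout p (w c) (fun=> 1) (g c) 1) <= (3 * n + 3) * M.
  by rewrite -blk sumn_block_le.
exists t, m; split=> // [i i_n|].
  rewrite (mx (Ordinal i_n)); case: (x _) => //.
  by apply: leq_trans b_lt.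
exists x; split=> // [j|i]; rewrite /paste size_mkseq.
  by rewrite leq_addr ltn_add2l ltn_ord nth_mkseq addKn ?add0n ?mx.
by move/negbTE ->.
Qed.

Lemma evaluate_spec (x : 'I_n -> bool) m0 : holds_input m0 ->
  (forall j : 'I_n, m0 (6 * n + 6 + j) = x j) ->
  wp S M Y evaluate m0 (fun m => m (slot 2) = weigh p x /\
    forall i, i != slot 1 -> i != slot 2 -> m i = m0 i).
Proof.
move=> inp0 resx.
pose frame (m : mem) := forall i, i != slot 1 -> i != slot 2 -> m i = m0 i.
have frame_input m : frame m -> holds_input m.
  by move=> fr; apply: stores_eq inp0 => i ?; apply: fr; rewrite /slot; lia.
pose partial k := \sum_(j < n | j < k) p j * x j.
have partial_n : partial n = weigh p x.
  by apply: eq_bigl => j; rewrite ltn_ord.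
have partial_le k : partial k <= M.
  apply: leq_trans p_le; rewrite /partial big_mkcond.
  by apply: leq_sum => j _; case: ifP => // _; case: (x j); lia.
rewrite /evaluate; apply: wp_seq.
apply: (wp_store (x := slot 2) (v := 0)) => //; first exact: eval_var.
set m1 := [eta m0 with _ |-> _].
pose summed k m := frame m /\ m (slot 2) = partial k.
apply: (@wp_conseq _ _ _ _ _ (summed n)).
  by move=> m [fr ->]; split.
apply: (wp_for (x := slot 1) (B := n)) => //.
- move=> k m [fr _]; have inp := frame_input _ fr.
  by rewrite eval_var //; split=> //; apply: input_nitems.
- move=> k v m [fr H]; split=> [i i1 i2|]; rewrite /= ifN ?H ?fr //.
  by rewrite /slot; lia.
- move=> k m kn [fr H] mk; have inp := frame_input _ fr.
  pose j := Ordinal kn.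
  apply: (wp_store (x := slot 2) (v := partial k.+1)).
  + exact: eval_var.
  + have evj : eval m (Fetch item) = j by rewrite eval_fetch_var.
    have [Ep _ _] := eval_items inp evj.
    rewrite -[LHS]/(eval m (Fetch value) + eval m (profit_at (Fetch item)) *
      m (eval m result + eval m (Fetch item))).
    rewrite Ep eval_fetch_var // eval_result // evj H fr; last 2 first.
      by rewrite /slot /=; lia.
      by rewrite /slot /=; lia.
    rewrite resx /partial [RHS](bigD1 j) /= ?ltnSn // addnC; congr addn.
    by apply: eq_bigl => i; rewrite -val_eqE /=; lia.
  + exact: partial_le.
  split; last by rewrite /= ifN // /slot; lia.
  split; last by rewrite /= eqxx.
  by move=> i i1 i2; rewrite /= ifN ?fr.
- split; first by move=> i i1 i2; rewrite /m1 /= ifN.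
  by rewrite /m1 /= eqxx /partial big_pred0.
Qed.

(** The vector that attains the best profit is only known to exist, since a
    later reply may have overwritten it in memory.
    At the start this is the zero vector with guess 0, both variables being
    initially 0. *)
Definition search_inv c (m : mem) : Prop :=
  [/\ holds_input m,
      forall c' y, c' < c -> weigh (w c') y <= g c' -> weigh p y <= m (slot 3),
      m (slot 4) <= b
    & exists2 x, weigh (w (m (slot 4))) x <= g (m (slot 4))
               & weigh p x = m (slot 3)].

Lemma search_inv_eq c m m' :
  (forall i, i < 3 * n + 3 -> m' i = m i) ->
  m' (slot 3) = m (slot 3) -> m' (slot 4) = m (slot 4) ->
  search_inv c m -> search_inv c m'.
Proof.
move=> eqm e3 e4 [inp H b4 ex]; rewrite /search_inv e3 e4; split=> //.
by apply: stores_eq inp => i ?; apply: eqm; lia.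
Qed.

Lemma try_guess_spec c m0 : c <= b -> search_inv c m0 -> m0 (slot 0) = c ->
  wp S M Y try_guess m0 (fun m => search_inv c.+1 m /\ m (slot 0) = c).
Proof.
move=> cb inv0 gc; have [inp0 _ _ _] := inv0.
rewrite /try_guess; apply: wp_seq.
apply: wp_conseq (write_knapsack_spec cb inp0 gc) => m1 [st1 fr1].
have inp1 : holds_input m1.
  by apply: stores_eq inp0 => i ?; apply: fr1; rewrite /slot; lia.
apply: wp_seq.
apply: wp_conseq (solve_knapsack_spec cb inp1 st1 (eval_result inp1)).
move=> m2 [x [optx resx fr2]].
have inp2 : holds_input m2.
  by apply: stores_eq inp1 => i ?; apply: fr2; lia.
apply: wp_seq; apply: wp_conseq (evaluate_spec inp2 resx) => m3 [val3 fr3].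
have eq3 i : i < 3 * n + 3 \/ i = slot 0 \/ i = slot 3 \/ i = slot 4 ->
    m3 i = m0 i.
  by rewrite /slot => iP; rewrite fr3 ?fr2 ?fr1 //; rewrite /slot; lia.
have inv3 : search_inv c m3.
  by apply: search_inv_eq inv0 => [i ?||]; apply: eq3; tauto.
have gc3 : m3 (slot 0) = c by rewrite eq3 //; tauto.
have [inp3 all3 b3 ex3] := inv3; have [fx maxx] := optx.
apply: wp_if;
  rewrite -[eval _ _]/(eval m3 (Fetch value) - eval m3 (Fetch best));
  rewrite !eval_fetch_var // val3 => cmp.
- apply: wp_seq.
  apply: (wp_store (x := slot 3) (v := weigh p x)).
  + exact: eval_var.
  + by rewrite eval_fetch_var.
  + exact: weigh_le.
  set m4 := [eta m3 with _ |-> _].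
  have m4E i : m4 i = if i == slot 3 then weigh p x else m3 i by [].
  clearbody m4.
  have inp4 : holds_input m4.
    by apply: stores_eq inp3 => i ?; rewrite m4E ifN // /slot; lia.
  apply: (wp_store (x := slot 4) (v := c)).
  + exact: eval_var.
  + by rewrite eval_fetch_var // m4E ifN // /slot; lia.
  + by apply: ltnW; apply: leq_ltn_trans b_lt.
  set m5 := [eta m4 with _ |-> _].
  have m5E i : m5 i = if i == slot 4 then c else m4 i by [].
  clearbody m5.
  split; last by rewrite m5E ifN ?m4E ?ifN //; rewrite /slot; lia.
  have e4 : m5 (slot 4) = c by rewrite m5E eqxx.
  have e3 : m5 (slot 3) = weigh p x.
    by rewrite m5E ifN ?m4E ?eqxx //; rewrite /slot; lia.
  split; rewrite ?e3 ?e4 //; last by exists x.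
    by apply: stores_eq inp4 => i ?; rewrite m5E ifN // /slot; lia.
  move=> c' y; rewrite ltnS leq_eqVlt => /predU1P[-> /maxx //|lt fy].
  by have := all3 _ _ lt fy; lia.
- apply: wp_skip; split=> //; split=> // c' y.
  rewrite ltnS leq_eqVlt => /predU1P[-> /maxx|]; last exact: all3.
  lia.
Qed.

(** The vector of the last call may differ from the one found in the search,
    but being optimal for the same knapsack problem it has at least its
    profit. *)
Lemma sockp_program_spec m0 : holds_input m0 ->
  m0 (slot 3) = 0 -> m0 (slot 4) = 0 ->
  wp S M Y sockp_program m0 (fun m => exists x : 'I_n -> bool,
    holds_vector m x /\ exists2 c, c <= b & weigh (w c) x <= g c /\
      forall c' y, c' <= b -> weigh (w c') y <= g c' -> weigh p y <= weigh p x).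
Proof.
move=> inp0 best0 guess0.
rewrite /sockp_program; apply: wp_seq; apply: wp_seq.
apply: (@wp_conseq _ _ _ _ _ (search_inv (b + 1))); last first.
  apply: (wp_for (x := slot 0) (B := b + 1)).
  - by rewrite addn1.
  - move=> c m [inp _ _ _]; rewrite eval_var //; split=> //.
    by rewrite -[LHS]/(eval m capacity + 1) eval_capacity.
  - move=> c k m; apply: search_inv_eq => [i ?||];
      by rewrite /= ifN // /slot; lia.
  - by move=> c m; rewrite addn1 ltnS; apply: try_guess_spec.
  - split; rewrite ?best0 ?guess0 //.
    by exists (fun=> false); rewrite /weigh big1 // => j _; rewrite muln0.
move=> m1 inv1; have [inp1 all1 b1 [x fx px]] := inv1.
apply: wp_seq; apply: (wp_store (x := slot 0) (v := m1 (slot 4))).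
- exact: eval_var.
- exact: eval_fetch_var.
- exact: leq_trans (ltnW b_lt).
set c := m1 (slot 4) in b1 fx *.
set m2 := [eta m1 with _ |-> _].
have inp2 : holds_input m2.
  by apply: stores_eq inp1 => i ?; rewrite /m2 /= ifN // /slot; lia.
have gc : m2 (slot 0) = c by rewrite /m2 /= eqxx.
apply: wp_conseq (write_knapsack_spec b1 inp2 gc) => m3 [st3 fr3].
have inp3 : holds_input m3.
  by apply: stores_eq inp2 => i ?; apply: fr3; rewrite /slot; lia.
have out0 : eval m3 (Cst 0) = 0 by [].
apply: wp_conseq (solve_knapsack_spec b1 inp3 st3 out0).
move=> m4 [x' [[fx' maxx'] resx' _]].
exists x'; split=> //; exists c => //; split=> // c' y c'b fy.
apply: leq_trans (maxx' _ fx); rewrite px; apply: all1 fy.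
by rewrite addn1.
Qed.

End Correctness.

(** * Pseudo-polynomial running time *)

(** The summands bound, in this order, the two parts of a weight of a knapsack
    instance, its capacity, and the numbers that the program copies or counts
    to. *)
Definition cell_bound (N : nat) : nat :=
  (2 * N + 1) * N + (N * N + N) * (N * N) + (N * (2 * N) + N) + (N + 1).

Lemma pb_cell_bound : polynomially_bounded cell_bound.
Proof.
by do ![apply: pb_cst | apply: pb_id | apply: pb_add | apply: pb_mul].
Qed.

Lemma sumn_layout n (f g h : 'I_n -> nat) x y :
  sumn (layout f g h x y) =
  n + (\sum_(j < n) f j + (\sum_(j < n) g j + (\sum_(j < n) h j + (x + y)))).
Proof.
have sumE (v : 'I_n -> nat) :
    sumn [seq v j | j <- enum 'I_n] = \sum_(j < n) v j.
  by rewrite sumnE big_map big_enum.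
by rewrite /layout /= !sumn_cat !sumE /= addn0.
Qed.

Lemma no_sub_seq_call c a l d k s : ~ halts no_sub (Seq c (Call a l d k)) s.
Proof.
move=> [t [m]] ex; inversion ex as [| |? ? ? ? ? ? ? _ ex2| | | | |].
by inversion ex2.
Qed.

(** Every linearized constraint implies the cone constraint, so [x] is feasible;
    a feasible [y] satisfies the one at c = b - A(y), so [x] beats it. *)
Lemma sockp_optimal_linearized (R : realType) (I : sockp_inst) x c :
  let w := linearized_weight (@sockp_mean I) (@sockp_stddev I)
             (sockp_capacity I) (sockp_Omega I) in
  let g := linear_capacity (sockp_capacity I) in
  c <= sockp_capacity I -> weigh (w c) x <= g c ->
  (forall c' y, c' <= sockp_capacity I -> weigh (w c') y <= g c' ->
     weigh (@sockp_profit I) y <= weigh (@sockp_profit I) x) ->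
  @sockp_optimal R I x.
Proof.
move=> w g cb fx max; apply/maximizes_natr; split.
  apply/sockp_feasible_nat; move: fx; rewrite weigh_comb.
  exact: linearized_sound (sockp_Omega_gt0 I) cb.
move=> y /sockp_feasible_nat[leb le_sq].
apply: (max (sockp_capacity I - weigh (@sockp_mean I) y)).
  exact: leq_subr.
by rewrite weigh_comb linearized_complete ?sockp_Omega_gt0.
Qed.

Lemma sockp_program_correct (R : realType) K :
  pseudo_polynomial_algorithm no_sub KP K ->
  pseudo_polynomial_algorithm (run no_sub K) (SOCKP R) sockp_program.
Proof.
move=> [q Kq].
pose Y N := (q.[(3 * cell_bound N + 3) * cell_bound N])%R.
have [r rP] : polynomially_bounded
    (fun N => time_bound (cell_bound N) (Y N) sockp_program).
  apply: pb_time_bound; first exact: pb_cell_bound.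
  apply: pb_comp; have p1 := pb_cell_bound.
  by do ![assumption | exact: pb_cst | apply: pb_add | apply: pb_mul].
exists r => I; rewrite [encode I]/(layout (@sockp_profit I) (@sockp_mean I)
  (@sockp_stddev I) (sockp_capacity I) (sockp_Omega I)).
case: I => n p a s b Om Om_gt0 /=.
set inp := layout p a s b Om; set N := sumn inp.
have Nsum : N = n + (\sum_(j < n) p j +
    (\sum_(j < n) a j + (\sum_(j < n) s j + (b + Om)))).
  exact: sumn_layout.
have le_sum (v : 'I_n -> nat) j : v j <= \sum_(i < n) v i.
  by rewrite (bigD1 j) //= leq_addr.
have aN j : a j <= N by have := le_sum a j; lia.
have sN j : s j <= N by have := le_sum s j; lia.
have bN : b <= N by lia.
have OmN : Om <= N by lia.
have NM : N < cell_bound N by rewrite /cell_bound; lia.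
have weight_le c j : c <= b -> linearized_weight a s b Om c j <= cell_bound N.
  move=> cb; rewrite /linearized_weight /cell_bound -addnA -addnA.
  apply: leq_add.
    by rewrite leq_mul // /mean_coef; lia.
  apply: leq_trans (leq_addr _ _); rewrite /var_coef -!mulnn.
  rewrite leq_mul ?leq_mul // leq_add ?leq_mul //.
  by case: c {cb} => [|c]; rewrite ?mul1n // (_ : 1 - c.+1 = 0).
have g_le c : c <= b -> linear_capacity b c <= cell_bound N.
  move=> cb; rewrite /cell_bound -addnA -addnA.
  apply: leq_trans (leq_addl _ _); apply: leq_trans (leq_addl _ _).
  apply: leq_trans (leq_addr _ _); rewrite /linear_capacity leq_add //.
    by rewrite leq_mul //; lia.
  by case: c {cb} => [|c]; rewrite ?mul1n // (_ : 1 - c.+1 = 0).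
pose w := linearized_weight a s b Om.
have solver c :
    sumn (layout p (w c) (fun=> 1) (linear_capacity b c) 1)
      <= (3 * n + 3) * cell_bound N ->
    exists t m, [/\ run no_sub K
        (layout p (w c) (fun=> 1) (linear_capacity b c) 1) t m, t <= Y N
      & exists x, holds_vector m x /\ knapsack_optimal p a s b Om c x].
  rewrite -kp_encode_knapsack => le_sumn.
  have [t [m [ex le_t [x [mx /kp_optimalP optx]]]]] :=
    Kq (knapsack p (w c) (linear_capacity b c)).
  exists t, m; split=> //; last by exists x.
  apply: leq_trans le_t _; apply: horner_nat_homo.
  by apply: leq_trans le_sumn _; rewrite leq_mul //; lia.
have inp0 : holds_input p a s b Om (nth 0 inp) by apply: stores_layout.
have out k : nth 0 inp (slot n k) = 0.
  by rewrite nth_default // size_layout /slot; lia.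
have bnd : bounded (cell_bound N) (nth 0 inp).
  move=> i; apply: leq_trans (ltnW NM); rewrite /N.
  elim: (inp) i => [|h l IH] [|i] //=; first by rewrite leq_addr.
  exact: leq_trans (IH i) (leq_addl _ _).
have nM : n <= cell_bound N by lia.
have bM : b < cell_bound N by lia.
have pM : \sum_(j < n) p j <= cell_bound N by lia.
have [t [m [ex le_t _ [x [mx [c cb [fx max]]]]]]] :=
  sockp_program_spec nM bM weight_le g_le pM solver inp0 (out 3) (out 4) bnd.
exists t, m; split=> //; first exact: leq_trans le_t (rP N).
exists x; split=> //.
exact: (@sockp_optimal_linearized R (SockpInst p a s b Om_gt0) x c cb fx max).
Qed.

Theorem theorem2 (R : realType) :
  exists P : cmd,
    (forall I : inst (SOCKP R), ~ halts no_sub P (encode I)) /\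
    forall K : cmd,
      pseudo_polynomial_algorithm no_sub KP K ->
      pseudo_polynomial_algorithm (run no_sub K) (SOCKP R) P.
Proof.
exists sockp_program; split; first by move=> I; apply: no_sub_seq_call.
exact: sockp_program_correct.
Qed.
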